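(* $\mathrm{yMCFT}=\mathrm{MCF}=\mathrm{yMRT}$; that is, the class of yield languages of tree languages generated by MCFTGs, the class of string languages generated by MCFGs, and the class of yield languages of tree languages generated by MRTGs coincide.
   Context: **Sequences and trees.** $\mathbb N_0$ is the set of nonnegative integers. $A^*$ (resp. $A^+$) is the set of finite (resp. nonempty finite) sequences over $A$; a sequence of length 1 is identified with its element; juxtaposition is concatenation; $\mathrm{occ}(w)$ is the set of elements occurring in the sequence $w$; $w$ is repetition-free if no element occurs twice in it. A ranked alphabet is a set $\Sigma$ with a rank map $\mathrm{rk}\colon\Sigma\to\mathbb N_0$ (applied elementwise to sequences); $\Sigma^{(k)}$ is the set of symbols of rank $k$. $T_\Sigma$ is the set of trees over $\Sigma$: the smallest set of strings over $\Sigma$ containing $\sigma t_1\cdots t_k$ (also written $\sigma(t_1,\dots,t_k)$) for all $\sigma\in\Sigma^{(k)}$ and $t_i\in T_\Sigma$. A forest is a finite sequence of trees. $X=\{x_1,x_2,\dots\}$ is a set of variables (of rank 0, disjoint from other alphabets), $X_k=\{x_1,\dots,x_k\}$. A pattern of rank $k$ over $\Sigma$ is a tree over $\Sigma\cup X_k$ in which each of $x_1,\dots,x_k$ occurs exactly once; $P_\Sigma(X_k)$ is the set of these and $P_\Sigma(X)=\bigcup_k P_\Sigma(X_k)$. For a forest $t$, $\mathrm{occ}_\Omega(t)$ is the set of symbols of $\Omega$ occurring in $t$; $t$ is uniquely $\Omega$-labeled if each symbol of $\Omega$ occurs at most once in $t$. **Substitution.** For a repetition-free sequence of symbols $\sigma=(\sigma_1,\dots,\sigma_n)$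 and patterns $u=(u_1,\dots,u_n)$ with $\mathrm{rk}(u)=\mathrm{rk}(\sigma)$, $t[\sigma\gets u]$ is obtained from $t$ by replacing, recursively, each subtree $\sigma_i(s_1,\dots,s_k)$ by $u_i$ in which $x_j$ is replaced by the transformed $s_j$ (componentwise on forests). For $\mathcal L=\{B_1,\dots,B_k\}$ with $B_1\cdots B_k$ repetition-free and forests $f(B_i)$ with $\mathrm{rk}(f(B_i))=\mathrm{rk}(B_i)$, $t[B\gets f(B)\mid B\in\mathcal L]$ means $t[B_1\cdots B_k\gets f(B_1)\cdots f(B_k)]$. **MCFTG.** A multiple context-free tree grammar (MCFTG) is $G=(N,\mathcal N,\Sigma,S,R)$ where $N$ is a finite ranked alphabet of nonterminals; $\mathcal N\subseteq N^+$ is a finite set of repetition-free sequences (big nonterminals) with $\mathrm{occ}(A)\ne\mathrm{occ}(A')$ for distinct $A,A'\in\mathcal N$; $\Sigma$ is a finite ranked alphabet of terminals, disjoint from $N$, containing a symbol of rank at least 1; $S\in\mathcal N\cap N^{(0)}$ is the initial nonterminal; $R$ is a finite set of rules $A\to(u,\mathcal L)$ with $A\in\mathcal N$, $u\in P_{N\cup\Sigma}(X)^+$ a uniquely $N$-labeled forest with $\mathrm{rk}(u)=\mathrm{rk}(A)$, and $\mathcal L\subseteq\mathcal N$ (the links) such that the sets $\mathrm{occ}(B)$, $B\in\mathcal L$, are pairwise disjoint with union $\mathrm{occ}_N(u)$. The sets $L(G,A)$, $A\in\mathcal N$, are simultaneously the smallest sets of forests such that for every rule $A\to(u,\mathcal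 L)$ and all $f(B)\in L(G,B)$ ($B\in\mathcal L$), $u[B\gets f(B)\mid B\in\mathcal L]\in L(G,A)$. $L(G)=L(G,S)\subseteq T_\Sigma$. An MRTG is an MCFTG all of whose nonterminals have rank 0. $\mathrm{MCFT}$ (resp. $\mathrm{MRT}$) is the class of tree languages generated by MCFTGs (resp. MRTGs). **MCFG.** A multiple context-free grammar (MCFG) is an MCFTG $(N\cup\{S\},\mathcal N,\Sigma\cup\{\triangleright\},S,R)$ with $S\notin N$ of rank 0, every nonterminal in $N$ of rank 1, $\triangleright\notin\Sigma$ of rank 0, every terminal in $\Sigma$ of rank 1, and $S$ not occurring in right-hand sides of rules. A string $w\in\Sigma^*$ is identified with the tree $w\triangleright\in T_{\Sigma\cup\{\triangleright\}}$, so an MCFG generates a string language over $\Sigma$. $\mathrm{MCF}$ is the class of string languages generated by MCFGs. **Yield.** $e$ is a special symbol of rank 0 representing the empty string. For $t\in T_\Sigma$, $\mathrm{yd}(t)$ is the string over $\Sigma^{(0)}\setminus\{e\}$ obtained from $t$ by erasing all symbols not in $\Sigma^{(0)}\setminus\{e\}$. For a class $\mathcal X$ of tree languages, $\mathrm y\mathcal X=\{\mathrm{yd}(L): L\in\mathcal X\}$. *)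

(* Defs.v *)
From HB Require Import structures.
From mathcomp Require Import all_boot.

Set Implicit Arguments.
Unset Strict Implicit.
Unset Printing Implicit Defensive.

Inductive tree (A : Type) : Type := Node of A & seq (tree A).

Fixpoint tree_map (A B : Type) (f : A -> B) (t : tree A) : tree B :=
  let: Node a ts := t in Node (f a) [seq tree_map f s | s <- ts].

(* The tree as a string of symbols in prefix (Polish) notation. *)
Fixpoint word (A : Type) (t : tree A) : seq A :=
  let: Node a ts := t in a :: flatten [seq word s | s <- ts].

Definition fword (A : Type) (u : seq (tree A)) : seq A :=
  flatten [seq word t | t <- u].

Fixpoint well_ranked (A : Type) (rk : A -> nat) (t : tree A) : bool :=
  let: Node a ts := t in (size ts == rk a) && all (well_ranked rk) ts.

Section TreeEq.
Variable A : eqType.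

Fixpoint tree_encode (t : tree A) : GenTree.tree A :=
  let: Node a ts := t in
  GenTree.Node 0 (GenTree.Leaf a :: [seq tree_encode s | s <- ts]).

Fixpoint tree_decode (g : GenTree.tree A) : option (tree A) :=
  if g is GenTree.Node _ (GenTree.Leaf a :: gs)
  then Some (Node a (pmap tree_decode gs)) else None.

Lemma tree_encodeK : pcancel tree_encode tree_decode.
Proof.
rewrite /pcancel; fix IH 1; case=> a ts /=; congr (Some (Node a _)).
by elim: ts => //= t ts IHts; rewrite IH /= IHts.
Qed.

HB.instance Definition _ := Equality.copy (tree A) (pcan_type tree_encodeK).
End TreeEq.

(* [Var j] is the variable x_{j+1}. *)
Inductive sym (N T : Type) : Type := NT of N | Tm of T | Var of nat.
Arguments NT {N T}.
Arguments Tm {N T}.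
Arguments Var {N T}.

Section SymEq.
Variables N T : eqType.

Definition sym_encode (a : sym N T) : N + T + nat :=
  match a with NT x => inl (inl x) | Tm b => inl (inr b) | Var j => inr j end.

Definition sym_decode (c : N + T + nat) : sym N T :=
  match c with inl (inl x) => NT x | inl (inr b) => Tm b | inr j => Var j end.

Lemma sym_encodeK : cancel sym_encode sym_decode.
Proof. by case. Qed.

HB.instance Definition _ := Equality.copy (sym N T) (can_type sym_encodeK).
End SymEq.

(* A finite ranked alphabet inside the universe [T]; [rank] is only meaningful
   on [letters]. *)
Record ralphabet (T : eqType) : Type :=
  RAlphabet { letters : seq T; rank : T -> nat }.

Section Substitution.
Variables (N : eqType) (T : Type).

Fixpoint fill (ss : seq (tree (sym N T))) (t : tree (sym N T)) :
    tree (sym N T) :=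
  match t with
  | Node (Var j) _ => nth t ss j
  | Node a ts => Node a [seq fill ss s | s <- ts]
  end.

(* t[sigma <- u] *)
Fixpoint subst (sigma : seq N) (u : seq (tree (sym N T)))
    (t : tree (sym N T)) : tree (sym N T) :=
  let: Node a ts := t in
  let ss := [seq subst sigma u s | s <- ts] in
  match a with
  | NT x => if x \in sigma then fill ss (nth t u (index x sigma)) else Node a ss
  | _ => Node a ss
  end.

(* t[B <- f(B) | B \in LL], componentwise on a forest *)
Definition fsubst (LL : seq (seq N)) (f : seq N -> seq (tree (sym N T)))
    (v : seq (tree (sym N T))) : seq (tree (sym N T)) :=
  [seq subst (flatten LL) (flatten [seq f B | B <- LL]) t | t <- v].
End Substitution.

Section Rules.
Variables (T : eqType) (Sg : ralphabet T) (N : finType) (rkN : N -> nat).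

Definition sym_rank (a : sym N T) : nat :=
  match a with NT x => rkN x | Tm b => rank Sg b | Var _ => 0 end.

(* [a] belongs to the union of N, Sigma and X_k. *)
Definition sym_over (k : nat) (a : sym N T) : bool :=
  match a with NT _ => true | Tm b => b \in letters Sg | Var j => j < k end.

Definition is_pattern (k : nat) (t : tree (sym N T)) : bool :=
  [&& well_ranked sym_rank t, all (sym_over k) (word t)
    & all (fun j => count_mem (Var j) (word t) == 1) (iota 0 k)].

Definition uniquely_labeled (u : seq (tree (sym N T))) : Prop :=
  forall x : N, count_mem (NT x) (fword u) <= 1.

(* The rule A -> (u, LL) is the triple (A, (u, LL)). *)
Definition rule : Type := seq N * (seq (tree (sym N T)) * seq (seq N)).

(* [LL] enumerates the set of links without repetition. *)
Definition is_rule (bigN : seq (seq N)) (r : rule) : Prop :=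
  let: (A, (u, LL)) := r in
  [/\ A \in bigN,
      all2 (fun x t => is_pattern (rkN x) t) A u,
      uniquely_labeled u,
      uniq LL /\ {subset LL <= bigN} &
      {in LL &, forall B B' : seq N, B != B' -> [disjoint B & B']} /\
      (forall x : N, (x \in flatten LL) = (NT x \in fword u))].
End Rules.

(* Nonterminals and terminals are disjoint by construction of [sym]. *)
Record mcftg (T : eqType) (Sg : ralphabet T) : Type := MCFTG {
  nonterm : finType;
  ntrank : nonterm -> nat;
  bignt : seq (seq nonterm);
  init : nonterm;
  rules : seq (rule T nonterm);
  bignt_rep_free : {in bignt, forall A : seq nonterm, A != [::] /\ uniq A};
  bignt_occ_inj : {in bignt &, forall A A' : seq nonterm, A != A' -> ~ A =i A'};
  term_rank_pos : has (fun b => 0 < rank Sg b) (letters Sg);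
  init_bignt : [:: init] \in bignt;
  init_rank : ntrank init = 0;
  rules_ok : {in rules, forall r, is_rule Sg ntrank bignt r}
}.

Inductive forest_lang (T : eqType) (Sg : ralphabet T) (G : mcftg Sg) :
    seq (nonterm G) -> seq (tree (sym (nonterm G) T)) -> Prop :=
| Forest_lang A u LL f :
    (A, (u, LL)) \in rules G ->
    (forall B, B \in LL -> forest_lang B (f B)) ->
    forest_lang A (fsubst LL f u).

(* L(G); its members contain terminal symbols only. *)
Definition tree_lang (T : eqType) (Sg : ralphabet T) (G : mcftg Sg)
    (t : tree T) : Prop :=
  forest_lang [:: init G] [:: tree_map Tm t].

Definition is_mrtg (T : eqType) (Sg : ralphabet T) (G : mcftg Sg) : Prop :=
  forall x : nonterm G, ntrank x = 0.

(* Classes of tree languages; a language comes with its ranked alphabet. *)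
Definition tree_class (T : eqType) : Type :=
  ralphabet T -> (tree T -> Prop) -> Prop.

Definition MCFT (T : eqType) : tree_class T := fun Sg M =>
  exists G : mcftg Sg, forall t, M t <-> tree_lang G t.

Definition MRT (T : eqType) : tree_class T := fun Sg M =>
  exists G : mcftg Sg, is_mrtg G /\ forall t, M t <-> tree_lang G t.

(* String languages are over [U]. The universe of terminal symbols is
   [option U]: the extra element [None] is the special symbol e in the
   setting of yields, and the end marker (triangle) in the setting of MCFGs,
   so that neither is ever a letter of a string. *)
Section StringLanguages.
Variable U : eqType.

Definition yd (Sg : ralphabet (option U)) (t : tree (option U)) : seq U :=
  pmap (fun b => if rank Sg b == 0 then b else None) (word t).

Definition yield_class (X : tree_class (option U)) (L : seq U -> Prop) : Prop :=
  exists (Sg : ralphabet (option U)) (M : tree (option U) -> Prop),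
    [/\ rank Sg None = 0, X Sg M
      & forall w, L w <-> exists2 t, M t & yd Sg t = w].

Definition is_mcfg (Sg : ralphabet (option U)) (G : mcftg Sg) : Prop :=
  [/\ None \in letters Sg /\ rank Sg None = 0,
      (forall a, Some a \in letters Sg -> rank Sg (Some a) = 1),
      (forall x : nonterm G, x != init G -> ntrank x = 1) &
      {in rules G, forall r, NT (init G) \notin fword r.2.1}].

Definition string_tree (w : seq U) : tree (option U) :=
  foldr (fun a t => Node (Some a) [:: t]) (Node None [::]) w.

Definition MCF (L : seq U -> Prop) : Prop :=
  exists (Sg : ralphabet (option U)) (G : mcftg Sg),
    is_mcfg G /\ forall w, L w <-> tree_lang G (string_tree w).
End StringLanguages.

(* Main.v *)
Require Import Defs.
From mathcomp Require Import all_boot.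

(** A tree derived from a component of a nonterminal of rank [k] contains each
    of its [k] variables once, so its yield is a word
    [g_0 x_{p 1} g_1 ... x_{p k} g_k].  Guessing the order [p] of the variables
    for every component, one replaces a component by the [k + 1] strings
    [g_i]; the links between the components of a big nonterminal are exactly
    what is needed to keep these strings, and the guesses, synchronized.  This
    turns any MCFTG into a grammar deriving tuples of strings (a multiple
    context-free grammar in the sense of Seki et al.).  Since an arbitrary
    valuation of the terminals may replace the yield, it also applies to MCFGs,
    which are special MCFTGs.  Conversely a grammar on tuples of strings
    becomes an MCFG by writing strings as monadic trees, and an MRTG by writing
    them as combs over a fresh binary symbol. *)

Set Implicit Arguments.
Unset Strict Implicit.
Unset Printing Implicit Defensive.

(** * Tree induction, finite choice and Cartesian products of lists *)

Lemma tree_ind_in (A : eqType) (P : tree A -> Prop) :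
  (forall a ts, (forall t, t \in ts -> P t) -> P (Node a ts)) ->
  forall t, P t.
Proof.
move=> IH; fix F 1; case=> a ts; apply: IH.
(* [F] is cleared so that automation cannot close the goal by an unguarded recursive call. *)
elim: ts => [|t ts IHts] s; first by clear F; rewrite in_nil.
rewrite inE; case/predU1P=> [->|sts]; [exact: F | exact: IHts].
Qed.

(** Turns the existence statements given by inductions on derivations into one function on the links
    of a rule. *)
Lemma finite_choice (X : eqType) (Y : Type) (y0 : Y) (P : X -> Y -> Prop)
    (s : seq X) :
  (forall x, x \in s -> exists y, P x y) ->
  exists f, forall x, x \in s -> P x (f x).
Proof.
elim: s => [|x s IHs] Ps; first by exists (fun=> y0).
have [y Py] := Ps x (mem_head x s).
have [|f Pf] := IHs; first by move=> z sz; apply: Ps; rewrite inE sz orbT.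
exists (fun z => if z == x then y else f z) => z; rewrite inE.
by case: eqP => [->|_ /Pf].
Qed.

Lemma map_nth_index (X : eqType) (Y : Type) (y0 : Y) (s : seq X) (r : seq Y) :
  uniq s -> size r = size s -> [seq nth y0 r (index x s) | x <- s] = r.
Proof.
elim: s r => [|x s IHs] [|y r] //= /andP[xs us] [sr]; rewrite eqxx /=.
congr (_ :: _); rewrite -[RHS]IHs //; apply/eq_in_map => z zs.
by case: eqP xs => [->|]; rewrite ?zs.
Qed.

Fixpoint cart_prod (X : Type) (ss : seq (seq X)) : seq (seq X) :=
  if ss is s :: ss' then [seq x :: r | x <- s, r <- cart_prod ss']
  else [:: [::]].

Lemma mem_cart_prod (X : eqType) (r : seq X) ss :
  (r \in cart_prod ss) = all2 (fun s x => x \in s) ss r.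
Proof.
elim: ss r => [|s ss IHss] r /=; first by case: r.
case: r => [|x r] /=; first by apply/allpairsP => [[p [_ _]]].
rewrite -IHss; apply/allpairsP/andP => [[[y q] /= [sy sq [-> ->]]] // | [sx sr]].
by exists (x, r).
Qed.

(** * Words with variables, cut at their variables *)

Section Words.
Variable V : Type.
Implicit Type w : seq (V + nat).

Definition lets w : seq V := pmap (fun x => if x is inl a then Some a else None) w.
Definition vars w : seq nat := pmap (fun x => if x is inr j then Some j else None) w.

(** The factors between consecutive variables, one more than there are variables. The result is
    never empty, so the default of [head] is never reached. *)
Fixpoint gaps w : seq (seq V) :=
  match w with
  | [::] => [:: [::]]
  | inl a :: w' => (a :: head [::] (gaps w')) :: behead (gaps w')
  | inr _ :: w' => [::] :: gaps w'
  end.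

Fixpoint merge_gaps (gs : seq (seq V)) (js : seq nat) : seq (V + nat) :=
  if gs is g :: gs' then
    map inl g ++ (if js is j :: js' then inr j :: merge_gaps gs' js' else [::])
  else [::].

Definition ngaps (js : seq nat) := (size js).+1.

(** The gaps of all components of a forest are stored as one flat tuple; the orders [jss] determine
    how to cut it back into components. *)
Definition interleave (jss : seq (seq nat)) (gs : seq (seq V)) : seq (seq (V + nat)) :=
  [seq merge_gaps p.1 p.2 | p <- zip (reshape (map ngaps jss) gs) jss].

(** An index out of range leaves the variable in place, in agreement with the default of [fill]. *)
Definition wsub (ss : seq (seq (V + nat))) w : seq (V + nat) :=
  flatten [seq match x with inl a => [:: inl a] | inr j => nth [:: inr j] ss j end
          | x <- w].

Lemma lets_cat w1 w2 : lets (w1 ++ w2) = lets w1 ++ lets w2.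
Proof. exact: pmap_cat. Qed.

Lemma vars_cat w1 w2 : vars (w1 ++ w2) = vars w1 ++ vars w2.
Proof. exact: pmap_cat. Qed.

Lemma wsub_cat ss w1 w2 : wsub ss (w1 ++ w2) = wsub ss w1 ++ wsub ss w2.
Proof. by rewrite /wsub map_cat flatten_cat. Qed.

Lemma wsub_flatten ss ws : wsub ss (flatten ws) = flatten (map (wsub ss) ws).
Proof. by elim: ws => //= w ws <-; rewrite wsub_cat. Qed.

Lemma wsub_inl ss (s : seq V) : wsub ss (map inl s) = map inl s.
Proof. by rewrite /wsub -map_comp; elim: s => //= a s ->. Qed.

Lemma lets_inl (s : seq V) : lets (map inl s) = s.
Proof. by elim: s => //= a s ->. Qed.

Lemma vars_inl (s : seq V) : vars (map inl s) = [::].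
Proof. by elim: s. Qed.

Lemma lets_flatten (ws : seq (seq (V + nat))) :
  lets (flatten ws) = flatten (map lets ws).
Proof. by elim: ws => //= w ws <-; rewrite lets_cat. Qed.

Lemma vars_flatten (ws : seq (seq (V + nat))) :
  vars (flatten ws) = flatten (map vars ws).
Proof. by elim: ws => //= w ws <-; rewrite vars_cat. Qed.

Lemma size_gaps w : size (gaps w) = ngaps (vars w).
Proof.
elim: w => //= -[a|j] w IHw /=; last by rewrite IHw.
by rewrite size_behead IHw.
Qed.

Lemma flatten_gaps w : flatten (gaps w) = lets w.
Proof.
elim: w => //= -[a|j] w IHw //=; rewrite -[in RHS]IHw.
by have := size_gaps w; case: (gaps w).
Qed.

Lemma gapsK w : merge_gaps (gaps w) (vars w) = w.
Proof.
elim: w => //= -[a|j] w IHw /=; rewrite -[in RHS]IHw //.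
by have := size_gaps w; case: (gaps w).
Qed.

Lemma gaps_no_vars w : vars w = [::] -> gaps w = [:: lets w].
Proof.
move=> w0; have := size_gaps w; rewrite -flatten_gaps w0.
by case: (gaps w) => [|g []] //=; rewrite cats0.
Qed.

Lemma vars_merge_gaps gs js : size gs = ngaps js -> vars (merge_gaps gs js) = js.
Proof.
elim: gs js => [|g gs IHgs] [|j js] //= [szg]; rewrite vars_cat vars_inl //=.
by congr (_ :: _); apply: IHgs.
Qed.

Lemma lets_merge_gaps gs js :
  size gs = ngaps js -> lets (merge_gaps gs js) = flatten gs.
Proof.
elim: gs js => [|g gs IHgs] [|j js] //= [szg]; rewrite lets_cat lets_inl //=.
  by case: gs szg {IHgs}.
by congr (_ ++ _); apply: IHgs.
Qed.

Lemma vars_interleave jss gs :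
  size gs = sumn (map ngaps jss) -> map vars (interleave jss gs) = jss.
Proof.
rewrite /interleave; elim: jss gs => [|js jss IHjss] gs //= szg.
rewrite vars_merge_gaps; last by rewrite size_takel // szg leq_addr.
by rewrite IHjss // size_drop szg addKn.
Qed.

Lemma lets_interleave jss gs :
  size gs = sumn (map ngaps jss) ->
  flatten (map lets (interleave jss gs)) = flatten gs.
Proof.
rewrite /interleave; elim: jss gs => [|js jss IHjss] gs /= szg.
  by case: gs szg.
rewrite lets_merge_gaps; last by rewrite size_takel // szg leq_addr.
rewrite IHjss; last by rewrite size_drop szg addKn.
by rewrite -flatten_cat cat_take_drop.
Qed.

Lemma interleave_gaps ws :
  interleave (map vars ws) (flatten (map gaps ws)) = ws.
Proof.
have shE: map ngaps (map vars ws) = shape (map gaps ws).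
  by rewrite /shape -!map_comp; apply: eq_map => w /=; rewrite size_gaps.
rewrite /interleave shE flattenK zip_map -map_comp -[RHS]map_id.
by apply: eq_map => w /=; rewrite gapsK.
Qed.

End Words.

(** Each variable occurs exactly once in [w], so no argument is deleted or duplicated; only the
    order changes. *)
Lemma perm_wsub (V : eqType) (ss : seq (seq (V + nat))) w :
  perm_eq (vars w) (iota 0 (size ss)) ->
  perm_eq (wsub ss w) (map inl (lets w) ++ flatten ss).
Proof.
move=> pw; have p1: perm_eq w (map inl (lets w) ++ map inr (vars w)).
  elim: w {pw} => //= -[a|j] w IHw; first by rewrite /= perm_cons.
  by rewrite /= perm_sym -[inr j :: map _ _]cat1s perm_catCA perm_cons perm_sym.
apply: (perm_trans (perm_flatten (perm_map _ p1))).
rewrite map_cat flatten_cat -!map_comp; apply: perm_cat.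
  by elim: (lets w) => //= a s; rewrite perm_cons.
apply: (perm_trans (perm_flatten (perm_map _ pw))).
have -> //: [seq nth [:: inr j] ss j | j <- iota 0 (size ss)] = ss.
rewrite -[RHS](mkseq_nth [::]); apply/eq_in_map => j.
by rewrite mem_iota => /= lej; apply: set_nth_default.
Qed.

(** * Letter homomorphisms that fix the variables *)

Section Homomorphisms.
Variables (V V' : Type) (h : V -> seq V').

Definition hom_word (s : seq V) : seq V' := flatten (map h s).

Definition hom (w : seq (V + nat)) : seq (V' + nat) :=
  flatten [seq match x with inl a => map inl (h a) | inr j => [:: inr j] end
          | x <- w].

Lemma hom_cat w1 w2 : hom (w1 ++ w2) = hom w1 ++ hom w2.
Proof. by rewrite /hom map_cat flatten_cat. Qed.

Lemma hom_flatten ws : hom (flatten ws) = flatten (map hom ws).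
Proof. by elim: ws => //= w ws <-; rewrite hom_cat. Qed.

Lemma hom_inl s : hom (map inl s) = map inl (hom_word s).
Proof. by elim: s => //= a s; rewrite /hom /hom_word /= map_cat => ->. Qed.

Lemma hom_wsub ss w : hom (wsub ss w) = wsub (map hom ss) (hom w).
Proof.
rewrite /wsub; elim: w => //= x w IHw.
rewrite hom_cat IHw -cat1s hom_cat map_cat flatten_cat; congr (_ ++ _).
case: x => [a|j]; rewrite /hom /= ?cats0.
  by elim: (h a) => //= b s <-.
case: (ltnP j (size ss)) => szj; first by rewrite (nth_map [:: inr j]).
by rewrite !nth_default // size_map.
Qed.

Lemma vars_hom w : vars (hom w) = vars w.
Proof.
rewrite /hom; elim: w => //= -[a|j] w IHw /=; rewrite ?vars_cat ?vars_inl //=.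
by rewrite IHw.
Qed.

Lemma gaps_hom w : gaps (hom w) = map hom_word (gaps w).
Proof.
elim: w => //= -[a|j] w /=; last by rewrite /hom /= => ->.
have := size_gaps w; case: (gaps w) => //= g gs _ IHw.
rewrite -cat1s hom_cat /hom_word /= {1}/hom /= cats0.
by elim: (h a) => [|b s IHs] /=; [rewrite IHw | rewrite IHs].
Qed.

Lemma hom_merge_gaps gs js :
  hom (merge_gaps gs js) = merge_gaps (map hom_word gs) js.
Proof.
elim: gs js => [|g gs IHgs] [|j js] //=; rewrite hom_cat hom_inl //.
by congr (_ ++ _); rewrite -IHgs.
Qed.

Lemma hom_interleave jss gs :
  map hom (interleave jss gs) = interleave jss (map hom_word gs).
Proof.
rewrite /interleave; elim: jss gs => [|js jss IHjss] gs //=.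
by rewrite IHjss hom_merge_gaps map_take map_drop.
Qed.

End Homomorphisms.

(** * Evaluation of trees to words *)

Section Evaluation.
Variables (N T : eqType).

Section Eval.
Variables (V : Type) (val : T -> seq V).

(* The yield of a tree: [val] gives the contribution of each terminal symbol
   and [g] that of each nonterminal, as a word with variables for its
   arguments. *)
Fixpoint ev (g : N -> seq (V + nat)) (t : tree (sym N T)) : seq (V + nat) :=
  let: Node a ts := t in
  match a with
  | NT x => wsub (map (ev g) ts) (g x)
  | Tm b => map inl (val b) ++ flatten (map (ev g) ts)
  | Var j => [:: inr j]
  end.

(** Meant for trees without nonterminals; a remaining nonterminal erases its whole subtree. *)
Definition ev0 := ev (fun=> [::]).

Lemma eq_in_ev g g' t :
  (forall x, NT x \in word t -> g x = g' x) -> ev g t = ev g' t.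
Proof.
elim/tree_ind_in: t => a ts IHts /= gE.
have tsE: map (ev g) ts = map (ev g') ts.
  apply/eq_in_map => t tts; apply: IHts => // x xt; apply: gE; rewrite inE.
  by apply/orP; right; apply/flattenP; exists (word t) => //; apply: map_f.
by case: a gE => [x|b|j] gE //; rewrite tsE // gE // mem_head.
Qed.

Lemma ev_fill ss t : ev0 (fill ss t) = wsub (map ev0 ss) (ev0 t).
Proof.
rewrite /ev0; set E := ev _.
elim/tree_ind_in: t => a ts IHts.
have tsE: map E (map (fill ss) ts) = map (wsub (map E ss)) (map E ts).
  by rewrite -!map_comp; apply/eq_in_map => t tts /=; apply: IHts.
case: a => [x|b|j] //=.
- by rewrite wsub_cat wsub_inl wsub_flatten; congr (_ ++ flatten _).
- rewrite /wsub /= cats0; case: (ltnP j (size ss)) => szj.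
    by rewrite (nth_map (Node (Var j) ts)).
  by rewrite !nth_default // size_map.
Qed.

(** Compositionality: at each replaced node, [ev_fill] turns the filling of tree variables into
    substitution in words. *)
Lemma ev_subst sigma u t :
  size u = size sigma ->
  ev0 (subst sigma u t) =
  ev (fun x => if x \in sigma then nth [::] (map ev0 u) (index x sigma) else [::]) t.
Proof.
move=> szu; elim/tree_ind_in: t => a ts IHts /=.
have tsE: map ev0 [seq subst sigma u s | s <- ts] = map (ev (fun x =>
    if x \in sigma then nth [::] (map ev0 u) (index x sigma) else [::])) ts.
  by rewrite -map_comp; apply/eq_in_map => t tts /=; apply: IHts.
case: a => [x|b|j] //=; last by rewrite -tsE.
case: ifP => // xs; rewrite ev_fill tsE; congr (wsub _ _).
by rewrite (nth_map (Node (NT x) ts)) // szu index_mem.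
Qed.

End Eval.

Lemma eq_ev V (val val' : T -> seq V) g : val =1 val' -> ev val g =1 ev val' g.
Proof.
move=> valE; elim/tree_ind_in=> a ts IHts /=.
by have /eq_in_map-> := IHts; case: a => // b; rewrite valE.
Qed.

(** Serves to specialize words over symbolic gaps to actual strings once the tuples derived from the
    links are known. *)
Lemma hom_ev V V' (h : V -> seq V') val g t :
  hom h (ev val g t) = ev (hom_word h \o val) (hom h \o g) t.
Proof.
elim/tree_ind_in: t => a ts IHts /=.
have tsE: map (hom h) (map (ev val g) ts) =
          map (ev (hom_word h \o val) (hom h \o g)) ts.
  by rewrite -map_comp; apply/eq_in_map => t tts /=; apply: IHts.
case: a => [x|b|j] //=; first by rewrite hom_wsub tsE.
by rewrite hom_cat hom_inl hom_flatten tsE.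
Qed.

Definition term_val (V : Type) (val : T -> seq V) (g : N -> seq (V + nat))
    (a : sym N T) : seq (V + nat) :=
  match a with
  | NT x => map inl (lets (g x))
  | Tm b => map inl (val b)
  | Var j => [:: inr j]
  end.

(** Up to order, evaluation just collects the contributions of the nodes: by [perm_wsub]
    nonterminals use each argument once, and variables have no children. Counts of variables and of
    gap symbols are both derived from this. *)
Lemma perm_ev (V : eqType) (val : T -> seq V) g (rk : sym N T -> nat) t :
  (forall j, rk (Var j) = 0) -> well_ranked rk t ->
  (forall x, NT x \in word t -> perm_eq (vars (g x)) (iota 0 (rk (NT x)))) ->
  perm_eq (ev val g t) (flatten (map (term_val val g) (word t))).
Proof.
move=> rkV; elim/tree_ind_in: t => a ts IHts /= /andP[/eqP sza wts] gP.
have tsP: perm_eq (flatten (map (ev val g) ts))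
   (flatten (map (term_val val g) (flatten (map (@word _) ts)))).
  have {}gP x : NT x \in flatten (map (@word _) ts) ->
    perm_eq (vars (g x)) (iota 0 (rk (NT x))).
    by move=> xts; apply: gP; rewrite inE xts orbT.
  elim: ts {sza} wts IHts gP => //= t ts IH /andP[wt wts] IHts gP.
  rewrite map_cat flatten_cat; apply: perm_cat.
    apply: IHts; rewrite ?mem_head // => x xt; apply: gP.
    by rewrite mem_cat xt.
  apply: IH => // [s sts|x xt]; last by apply: gP; rewrite mem_cat xt orbT.
  by apply: IHts; rewrite inE sts orbT.
case: a sza gP => [x|b|j] /= sza gP.
- apply: (perm_trans (perm_wsub _)).
    by rewrite size_map sza; apply: gP; rewrite mem_head.
  by rewrite perm_cat2l.
- by rewrite perm_cat2l.
by move: sza; rewrite rkV => /size0nil ->.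
Qed.

End Evaluation.

(** * From tree grammars to grammars on tuples of strings *)

Definition lefts (X Y : Type) (s : seq (X + Y)) : seq X :=
  pmap (fun a => if a is inl x then Some x else None) s.

Definition rights (X Y : Type) (s : seq (X + Y)) : seq Y :=
  pmap (fun a => if a is inr y then Some y else None) s.

(* A multiple context-free grammar in the style of Seki et al.: a key [k]
   derives [dim k]-tuples of strings, and in a rule [(k, (us, ks))] the symbol
   [inr (k', j)] stands for component [j] of the tuple derived from the link
   [k']. *)
Record sgrammar (U : eqType) := SGrammar {
  key : choiceType;
  keys : seq key;
  dim : key -> nat;
  start : key;
  srules : seq (key * (seq (seq (U + key * nat)) * seq key));
  dim_gt0 : {in keys, forall k, 0 < dim k};
  start_key : start \in keys;
  dim_start : dim start = 1;
  srules_ok : {in srules, forall r,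
    [/\ r.1 \in keys, {subset r.2.2 <= keys}, uniq r.2.2,
        size r.2.1 = dim r.1 &
        perm_eq (rights (flatten r.2.1))
                [seq (k, j) | k <- r.2.2, j <- iota 0 (dim k)]]}
}.

Definition expand (U K : Type) (f : K -> seq (seq U)) (a : U + K * nat) : seq U :=
  match a with inl b => [:: b] | inr (k, j) => nth [::] (f k) j end.

Inductive slang (U : eqType) (H : sgrammar U) : key H -> seq (seq U) -> Prop :=
| Slang k us ks f :
    (k, (us, ks)) \in srules H ->
    (forall k', k' \in ks -> slang k' (f k')) ->
    slang k (map (hom_word (expand f)) us).

Lemma all2_map_impl (X Y Z W : eqType) (r : X -> Y -> bool) (r' : Z -> W -> bool)
    (f : X -> Z) (g : Y -> W) s t :
  all2 r s t ->
  (forall x y, x \in s -> y \in t -> r x y -> r' (f x) (g y)) ->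
  all2 r' (map f s) (map g t).
Proof.
elim: s t => [|x s IHs] [|y t] //= /andP[rxy rst] rr'.
rewrite rr' ?mem_head // IHs // => x' y' sx' ty'.
by apply: rr'; rewrite inE ?sx' ?ty' orbT.
Qed.

Lemma all2_size (X Y : Type) (r : X -> Y -> bool) s t : all2 r s t -> size s = size t.
Proof. by elim: s t => [|x s IHs] [|y t] //= /andP[_ /IHs->]. Qed.

Lemma all2_nth_index (X : eqType) (Y : Type) (r : X -> Y -> bool) y0 s t x :
  all2 r s t -> x \in s -> r x (nth y0 t (index x s)).
Proof.
elim: s t => [|x' s IHs] [|y t] //= /andP[rxy rst]; rewrite inE eq_sym.
by case: eqP => [<-|_ /IHs] //=; apply.
Qed.

Lemma nth_index_cart_prod (X : eqType) (Y : eqType) (g : X -> seq Y) y0 r s x :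
  r \in cart_prod (map g s) -> x \in s -> nth y0 r (index x s) \in g x.
Proof.
rewrite mem_cart_prod; elim: s r => [|x' s IHs] [|y r] //= /andP[gy rP].
by rewrite inE eq_sym; case: eqP => [<-|_ /(IHs _ rP)].
Qed.

Lemma map_cart_prod (X : eqType) (Y : eqType) (g : X -> seq Y) (f : X -> Y) s :
  {in s, forall x, f x \in g x} -> map f s \in cart_prod (map g s).
Proof.
rewrite mem_cart_prod; elim: s => [|x s IHs] //= fg.
by rewrite fg ?mem_head // IHs // => y sy; apply: fg; rewrite inE sy orbT.
Qed.

(** * Locating a nonterminal in the links of a rule *)

Section Links.
Variable N : eqType.
Implicit Types (LL : seq (seq N)) (x : N).

(** The link that owns [x]; when links are disjoint, it is the only one containing [x]. *)
Definition link LL x : seq N := nth [::] LL (find (fun B => x \in B) LL).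

Lemma link_mem LL x : x \in flatten LL -> link LL x \in LL.
Proof.
by case/flattenP=> B LLB Bx; apply: mem_nth; rewrite -has_find; apply/hasP; exists B.
Qed.

Lemma mem_link LL x : x \in flatten LL -> x \in link LL x.
Proof.
case/flattenP=> B LLB Bx; apply: (@nth_find _ [::] (fun B => x \in B)).
by apply/hasP; exists B.
Qed.

(** [fsubst] works on the concatenation of all links. Both [index] there and [find] in [link] stop
    at the first link containing [x], and the equal sizes keep the two concatenations aligned. *)
Lemma nth_flatten_link (Y : Type) (y0 : Y) (f : seq N -> seq Y) LL x :
  {in LL, forall B, size (f B) = size B} -> x \in flatten LL ->
  nth y0 (flatten (map f LL)) (index x (flatten LL)) =
  nth y0 (f (link LL x)) (index x (link LL x)).
Proof.
rewrite /link; elim: LL => //= B LL IHLL szf; rewrite mem_cat.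
rewrite nth_cat index_cat szf ?mem_head //=.
case Bx: (x \in B) => /=; first by rewrite index_mem Bx.
rewrite ltnNge leq_addr /= addKn => LLx; apply: IHLL => // C LLC.
by apply: szf; rewrite inE LLC orbT.
Qed.

Lemma size_flatten_link (Y : Type) (f : seq N -> seq Y) LL :
  {in LL, forall B, size (f B) = size B} ->
  size (flatten (map f LL)) = size (flatten LL).
Proof.
move=> szf; rewrite !size_flatten /shape -map_comp.
by congr sumn; apply/eq_in_map.
Qed.

End Links.

Section DisjointLinks.
Variable N : finType.
Variable LL : seq (seq N).
Hypothesis LLdis : {in LL &, forall B B' : seq N, B != B' -> [disjoint B & B']}.

Lemma linkE B x : B \in LL -> x \in B -> link LL x = B.
Proof.
move=> LLB Bx; have LLx : x \in flatten LL by apply/flattenP; exists B.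
case: (eqVneq (link LL x) B) => // /(LLdis (link_mem LLx) LLB).
by move/disjointFr/(_ (mem_link LLx)); rewrite Bx.
Qed.

Lemma uniq_flatten_links :
  uniq LL -> {in LL, forall B, uniq B} -> uniq (flatten LL).
Proof.
elim: LL LLdis => //= B L IHL dis /andP[BL uL] uB.
have subL C : C \in L -> C \in B :: L by move=> LC; rewrite inE LC orbT.
rewrite cat_uniq uB ?mem_head // IHL //=; last first.
- by move=> C /subL/uB.
- by move=> C C' /subL LC /subL LC'; apply: dis.
rewrite andbT; apply/hasPn => x /flattenP[C LC Cx].
have BC : B != C by apply: contraNneq BL => ->.
by apply: contraTN Cx => /(disjointFr (dis _ _ (mem_head _ _) (subL _ LC) BC)) ->.
Qed.

End DisjointLinks.

(** * Trees without nonterminals, and the words of patterns *)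

Section NonterminalFree.
Variables (T : eqType) (Sg : ralphabet T) (N : finType) (rkN : N -> nat).
Implicit Type t : tree (sym N T).
Local Notation rk := (sym_rank Sg rkN).

Definition term_over (k : nat) (a : sym N T) : bool :=
  if a is NT _ then false else sym_over Sg k a.

(** That each variable occurs once is recorded separately, as a property of the evaluated word. *)
Definition nt_free k t := well_ranked rk t && all (term_over k) (word t).

Lemma all_fword (P : pred (sym N T)) ts :
  all P (fword ts) = all (fun t => all P (word t)) ts.
Proof. by rewrite /fword; elim: ts => //= t ts <-; rewrite all_cat. Qed.

Lemma nt_free_node k a ts :
  nt_free k (Node a ts) =
  [&& size ts == rk a, term_over k a & all (nt_free k) ts].
Proof.
have -> : all (nt_free k) ts =
    all (well_ranked rk) ts && all (fun t => all (term_over k) (word t)) ts.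
  by rewrite -all_predI.
rewrite {1}/nt_free /= -/(fword ts) all_fword -!andbA.
by congr (_ && _); rewrite andbCA.
Qed.

Lemma nt_free_fill k k' ss t :
  size ss = k -> all (nt_free k') ss -> nt_free k t -> nt_free k' (fill ss t).
Proof.
move=> szs css; elim/tree_ind_in: t => a ts IHts; rewrite nt_free_node.
case/and3P=> szt ak /allP cts.
case: a szt ak => [x|b|j] //= szt ak.
  rewrite nt_free_node /= size_map szt ak /=.
  by apply/allP => s /mapP[t tts ->]; apply: IHts => //; apply: cts.
by apply: (allP css); rewrite mem_nth // szs.
Qed.

Lemma nt_free_subst t0 k sigma u t :
  size u = size sigma ->
  {in sigma, forall x, nt_free (rkN x) (nth t0 u (index x sigma))} ->
  {subset [pred x | NT x \in word t] <= sigma} ->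
  well_ranked rk t -> all (sym_over Sg k) (word t) ->
  nt_free k (subst sigma u t).
Proof.
move=> szu cu; elim/tree_ind_in: t => a ts IHts.
rewrite /= -/(fword ts) all_fword => sub /andP[szt /allP wts] /andP[ak /allP ots].
have cts: all (nt_free k) [seq subst sigma u s | s <- ts].
  apply/allP => s /mapP[t tts ->]; apply: IHts; rewrite ?wts ?ots //.
  move=> x xt; apply: sub; rewrite inE /= inE; apply/orP; right.
  by apply/flattenP; exists (word t) => //; apply: map_f.
case: a sub szt ak => [x|b|j] //= sub szt ak.
- have xs: x \in sigma by apply: sub; rewrite !inE eqxx.
  rewrite xs (set_nth_default t0) ?szu ?index_mem //.
  by apply: nt_free_fill (cu _ xs) => //; rewrite size_map; apply/eqP.
- by rewrite nt_free_node /= size_map szt ak.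
- by rewrite nt_free_node /= size_map szt ak.
Qed.

Lemma nt_free0_map t : nt_free 0 t -> exists t' : tree T, t = tree_map Tm t'.
Proof.
elim/tree_ind_in: t => a ts IHts; rewrite nt_free_node => /and3P[_ a0 /allP cts].
case: a a0 => // b _.
have [ts' ->]: exists ts' : seq (tree T), ts = map (tree_map Tm) ts'.
  elim: ts IHts cts => [|t ts IH] IHts cts; first by exists [::].
  have [t' ->] := IHts t (mem_head _ _) (cts t (mem_head _ _)).
  have [s sts|s sts|ts' ->] := IH.
  - by apply: IHts; rewrite inE sts orbT.
  - by apply: cts; rewrite inE sts orbT.
  by exists (t' :: ts').
by exists (Node b ts').
Qed.

Definition nts (w : seq (sym N T)) : seq N :=
  pmap (fun a => if a is NT x then Some x else None) w.

Lemma count_nts w x : count_mem x (nts w) = count_mem (NT x) w.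
Proof. by elim: w => //= -[y|b|j] w <-. Qed.

Lemma mem_nts w x : (x \in nts w) = (NT x \in w).
Proof. by rewrite -!has_pred1 !has_count count_nts. Qed.

Section Yields.
Variables (V : eqType) (val : T -> seq V).

(** In [perm_ev] nonterminals and terminals contribute letters only, so the variables of the word
    are those of the pattern, each of which occurs once. *)
Lemma pattern_vars k g t :
  is_pattern Sg rkN k t ->
  (forall x, NT x \in word t -> perm_eq (vars (g x)) (iota 0 (rkN x))) ->
  perm_eq (vars (ev val g t)) (iota 0 k).
Proof.
case/and3P=> wt ot ct gP.
have := perm_ev val (rk := rk) (fun=> erefl) wt gP.
move/(perm_pmap (fun x => if x is inr j then Some j else None)).
rewrite -![pmap _ _]/(vars _) vars_flatten -map_comp => /perm_trans; apply.
have {gP wt}-> : flatten (map (@vars V \o term_val val g) (word t)) =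
    pmap (fun a => if a is Var j then Some j else None) (word t).
  by elim: (word t) => //= -[x|b|j] w ->; rewrite /= ?vars_inl.
apply/allP => j _ /=; apply/eqP.
have -> : forall w : seq (sym N T),
    count_mem j (pmap (fun a => if a is Var j then Some j else None) w)
    = count_mem (Var j) w.
  by elim=> //= -[x|b|j'] w <-.
rewrite (count_uniq_mem _ (iota_uniq _ _)) mem_iota /= add0n.
case: ltnP => [jk|kj].
  by apply/eqP; apply: (allP ct); rewrite mem_iota.
apply/count_memPn; apply/negP => /(allP ot) /=.
by rewrite ltnNge kj.
Qed.

Lemma perm_lets_ev g ts :
  all (well_ranked rk) ts ->
  (forall x, NT x \in fword ts -> perm_eq (vars (g x)) (iota 0 (rkN x))) ->
  perm_eq (lets (flatten (map (ev val g) ts)))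
          (flatten [seq lets (term_val val g a) | a <- fword ts]).
Proof.
move=> wts gP.
suff /(perm_pmap (fun x => if x is inl a then Some a else None)):
    perm_eq (flatten (map (ev val g) ts)) (flatten (map (term_val val g) (fword ts))).
  by rewrite -![pmap _ _]/(lets _) [in X in perm_eq _ X]lets_flatten -map_comp.
rewrite /fword in gP *; elim: ts wts gP => //= t ts IHts /andP[wt wts] gP.
rewrite map_cat flatten_cat; apply: perm_cat.
  by apply: perm_ev wt _ => // x xt; apply: gP; rewrite mem_cat xt.
by apply: IHts => // x xt; apply: gP; rewrite mem_cat xt orbT.
Qed.

End Yields.
End NonterminalFree.

(** * Evaluation and well-formedness of derived forests *)

Section FSubst.
Variables (T : eqType) (N : finType) (V : Type) (val : T -> seq V).

Lemma ev_fsubst (LL : seq (seq N)) f (ts : seq (tree (sym N T))) :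
  {in LL, forall B, size (f B) = size B} ->
  (forall x, NT x \in fword ts -> x \in flatten LL) ->
  map (ev0 val) (fsubst LL f ts) =
  map (ev val (fun x => nth [::] (map (ev0 val) (f (link LL x)))
                            (index x (link LL x)))) ts.
Proof.
move=> szf sub; rewrite /fsubst -map_comp; apply/eq_in_map => t tts /=.
rewrite ev_subst ?size_flatten_link //; apply: eq_in_ev => x xt.
have LLx : x \in flatten LL.
  by apply: sub; apply/flattenP; exists (word t) => //; apply: map_f.
rewrite LLx map_flatten -map_comp nth_flatten_link // => B LLB.
by rewrite /= size_map szf.
Qed.

End FSubst.

Section ForestFacts.
Variables (T : eqType) (Sg : ralphabet T) (G : mcftg Sg).
Variables (V : eqType) (val : T -> seq V).
Local Notation N := (nonterm G).
Local Notation rkN := (@ntrank _ _ G).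

Definition well_formed (x : N) (t : tree (sym N T)) : bool :=
  nt_free Sg rkN (rkN x) t && perm_eq (vars (ev0 val t)) (iota 0 (rkN x)).

(** Induction on the derivation: [nt_free_subst] shows that no nonterminal is left, and
    [pattern_vars] counts the variables. *)
Lemma forest_lang_well_formed A v :
  forest_lang A v -> A \in bignt G /\ all2 well_formed A v.
Proof.
elim=> {A v} A u LL f rG _ IHf.
have [AG pu _ [uLL LLG] [LLdis LLu]] := rules_ok rG; split => //.
have szf : {in LL, forall B, size (f B) = size B}.
  by move=> B /IHf[_ /all2_size].
have uf x : x \in flatten LL -> well_formed x
    (nth (Node (NT x) [::]) (f (link LL x)) (index x (link LL x))).
  move=> LLx; have [_ vB] := IHf _ (link_mem LLx).
  exact: all2_nth_index vB (mem_link LLx).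
have subu x : NT x \in fword u -> x \in flatten LL by rewrite LLu.
suff : all2 well_formed (map id A) (fsubst LL f u) by rewrite map_id.
apply: all2_map_impl pu _ => x t Ax ut px; apply/andP; split.
  have /and3P[wt ot _] := px.
  apply: (@nt_free_subst _ _ _ _ (Node (NT x) [::])) => //.
  - exact: size_flatten_link.
  - move=> y LLy; rewrite nth_flatten_link //.
    have /andP[] := uf y LLy; rewrite (set_nth_default (Node (NT x) [::])) //.
    by rewrite szf ?index_mem ?mem_link ?link_mem.
  - by move=> y yt; apply: subu; apply/flattenP; exists (word t); rewrite ?map_f.
rewrite ev_subst ?size_flatten_link //; apply: pattern_vars px _ => y yt.
have LLy : y \in flatten LL.
  by apply: subu; apply/flattenP; exists (word t); rewrite ?map_f.
rewrite LLy map_flatten -map_comp nth_flatten_link // => [|B LLB]; last first.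
  by rewrite /= size_map szf.
rewrite /= (nth_map (Node (NT y) [::])) ?szf ?index_mem ?mem_link ?link_mem //.
by case/andP: (uf y LLy).
Qed.

End ForestFacts.

Lemma forest_lang_size (T : eqType) (Sg : ralphabet T) (G : mcftg Sg) A v :
  @forest_lang _ _ G A v -> size v = size A.
Proof. by case=> {}A u LL f /rules_ok[_ /all2_size-> _ _ _] _; rewrite size_map. Qed.

Lemma size_flatten_gaps (V : Type) (ys : seq (seq (V + nat))) :
  size (flatten (map (@gaps V) ys)) = sumn (map ngaps (map (@vars V) ys)).
Proof.
rewrite size_flatten /shape -!map_comp; congr sumn.
by apply: eq_map => y /=; rewrite size_gaps.
Qed.

Lemma eq_perm (X : eqType) (s s' : seq X) : s = s' -> perm_eq s s'.
Proof. by move->. Qed.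

Lemma flatten_flatten (X : Type) (sss : seq (seq (seq X))) :
  flatten (flatten sss) = flatten (map flatten sss).
Proof. by elim: sss => //= ss sss <-; rewrite flatten_cat. Qed.

Lemma rights_flatten (X Y : Type) (ss : seq (seq (X + Y))) :
  rights (flatten ss) = flatten (map (@rights X Y) ss).
Proof. by elim: ss => //= s ss <-; apply: pmap_cat. Qed.

Lemma rights_inr (X Y : Type) (s : seq Y) : rights (map (@inr X Y) s) = s.
Proof. by elim: s => //= y s ->. Qed.

(** * The grammar deriving the gaps of component yields *)

Section YieldGrammar.
Variables (T : eqType) (Sg : ralphabet T) (G : mcftg Sg).
Variables (U : eqType) (val : T -> seq U).
Local Notation N := (nonterm G).
Local Notation rkN := (@ntrank _ _ G).

(* A key [(A, jss)] derives, for every forest of [A] whose components have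
   their variables in the orders [jss], the tuple of all strings between
   consecutive variables in the yields of the components. *)
Definition ykey : choiceType := (seq N * seq (seq nat))%type.

Definition ydim (k : ykey) : nat := sumn (map ngaps k.2).

Definition orders (A : seq N) : seq (seq (seq nat)) :=
  cart_prod [seq permutations (iota 0 (rkN x)) | x <- A].

Definition ykeys : seq ykey := [seq (A, jss) | A <- bignt G, jss <- orders A].

(** Symbolic components: the still unknown gap number [j] is the single letter [(k, j)], and the
    guessed orders place the variables between these letters. *)
Definition ywords (k : ykey) : seq (seq ((U + ykey * nat) + nat)) :=
  interleave k.2 [seq [:: inr (k, j)] | j <- iota 0 (ydim k)].

Definition yval (b : T) : seq (U + ykey * nat) := map inl (val b).

Section Rule.
Variables (LL : seq (seq N)) (os : seq (seq (seq nat))).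

(** [os] holds one guess for each link, aligned with [LL]. *)
Definition order_of (B : seq N) : seq (seq nat) := nth [::] os (index B LL).

Definition ykey_of (B : seq N) : ykey := (B, order_of B).

Definition yword (x : N) : seq ((U + ykey * nat) + nat) :=
  nth [::] (ywords (ykey_of (link LL x))) (index x (link LL x)).

Definition ywords_of (u : seq (tree (sym N T))) := map (ev yval yword) u.

End Rule.

(** Only the orders of the links are guessed; those of the left-hand side are read off from the
    evaluated right-hand side. *)
Definition yrule (r : rule T N) os :
    ykey * (seq (seq (U + ykey * nat)) * seq ykey) :=
  let: (A, (u, LL)) := r in
  let ys := ywords_of LL os u in
  ((A, map (@vars _) ys), (flatten (map (@gaps _) ys), map (ykey_of LL os) LL)).

Definition yrules :=
  [seq yrule r os | r <- rules G, os <- cart_prod (map orders r.2.2)].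

Lemma mem_ykeys (A : seq N) jss :
  ((A, jss) \in ykeys) = (A \in bignt G) && (jss \in orders A).
Proof.
apply/allpairsPdep/andP => [[B [js [BG Bjs [-> ->]]]] // | [AG Ajss]].
by exists A, jss.
Qed.

Lemma size_orders A jss : jss \in orders A -> size jss = size A.
Proof. by rewrite mem_cart_prod => /all2_size <-; rewrite size_map. Qed.

Lemma vars_ywords k : map (@vars _) (ywords k) = k.2.
Proof. by rewrite vars_interleave // size_map size_iota. Qed.

Lemma size_ywords k : size (ywords k) = size k.2.
Proof. by rewrite -[in RHS](vars_ywords k) [RHS]size_map. Qed.

Lemma lets_ywords k :
  flatten (map (@lets _) (ywords k)) = [seq inr (k, j) | j <- iota 0 (ydim k)].
Proof.
rewrite lets_interleave ?size_map ?size_iota //.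
by rewrite (map_comp (fun x => [:: x])) flatten_seq1.
Qed.

(* The symbolic words specialize to the yields of any forest with the guessed
   orders of variables. *)
Lemma hom_ywords f A (ys : seq (seq (U + nat))) (k := (A, map (@vars _) ys) : ykey) :
  f k = flatten (map (@gaps _) ys) -> map (hom (expand f)) (ywords k) = ys.
Proof.
move=> fk; rewrite hom_interleave -[RHS]interleave_gaps; congr interleave.
rewrite -map_comp -[RHS](mkseq_nth [::]) size_flatten_gaps.
by apply: eq_map => j; rewrite /= /hom_word /= cats0 fk.
Qed.

Section RuleFacts.
Variables (A : seq N) (u : seq (tree (sym N T))) (LL : seq (seq N)).
Hypothesis rG : (A, (u, LL)) \in rules G.
Variable os : seq (seq (seq nat)).
Hypothesis osP : os \in cart_prod (map orders LL).

Lemma orders_of B : B \in LL -> order_of LL os B \in orders B.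
Proof. exact: nth_index_cart_prod osP. Qed.

Lemma vars_yword x :
  x \in flatten LL -> perm_eq (vars (yword LL os x)) (iota 0 (rkN x)).
Proof.
move=> LLx; have oP := orders_of (link_mem LLx).
rewrite -[vars _](nth_map _ [::]); last first.
  by rewrite size_ywords (size_orders oP) index_mem mem_link.
rewrite vars_ywords -mem_permutations.
exact: (nth_index_cart_prod _ oP (mem_link LLx)).
Qed.

Lemma vars_ywords_of : map (@vars _) (ywords_of LL os u) \in orders A.
Proof.
have [_ pu _ _ [_ LLu]] := rules_ok rG.
rewrite mem_cart_prod /ywords_of -map_comp.
apply: all2_map_impl pu _ => x t Ax ut px; rewrite mem_permutations.
apply: pattern_vars px _ => y yt; apply: vars_yword.
by rewrite LLu; apply/flattenP; exists (word t); rewrite ?map_f.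
Qed.

(** Linearity: unique labeling and disjoint links covering the nonterminals of [u] make each
    component of each link occur once, hence each gap symbol once. *)
Lemma rights_ywords_of :
  perm_eq (rights (lets (flatten (ywords_of LL os u))))
          [seq (k, j) | k <- map (ykey_of LL os) LL, j <- iota 0 (ydim k)].
Proof.
have [_ pu uu [uLL LLG] [LLdis LLu]] := rules_ok rG.
have wu : all (well_ranked (sym_rank Sg rkN)) u.
  by elim: (A) (u) pu => [|x s IHs] [|t ts] //= /andP[/and3P[-> _ _] /IHs].
have gP x : NT x \in fword u -> perm_eq (vars (yword LL os x)) (iota 0 (rkN x)).
  by rewrite -LLu; apply: vars_yword.
have /(perm_pmap (fun a => if a is inr y then Some y else None)) :=
  perm_lets_ev yval wu gP.
rewrite -![pmap _ _]/(rights _) => /perm_trans; apply.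
(* Terminals contribute letters of [U] and variables no letter at all, so only nonterminals bring
   gap symbols. *)
have -> : rights (flatten [seq lets (term_val yval (yword LL os) a) | a <- fword u]) =
    flatten [seq rights (lets (yword LL os x)) | x <- nts (fword u)].
  elim: (fword u) => //= a w IHw.
  rewrite [LHS]pmap_cat -/(rights _) -/(rights _) IHw.
  case: a => [x|b|j] //=; rewrite lets_inl //.
  by rewrite /yval; elim: (val b) => //= c s.
have uB : {in LL, forall B, uniq B} by move=> B /LLG /(bignt_rep_free (m := G))[].
(* Both lists have the same elements and no repetitions, by unique labeling on one side and
   disjointness of the links on the other. *)
have /(perm_map (fun x => rights (lets (yword LL os x)))) /perm_flatten :
    perm_eq (nts (fword u)) (flatten LL).
  apply: uniq_perm => [||x]; last by rewrite mem_nts LLu.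
    apply: count_mem_uniq => x; rewrite -has_pred1 has_count count_nts.
    by have := uu x; case: (count_mem _ _) => [|[]].
  exact: uniq_flatten_links.
move=> /perm_trans; apply.
rewrite map_flatten flatten_flatten -!map_comp.
apply: eq_perm; congr flatten; apply/eq_in_map => B LLB /=.
have -> : [seq rights (lets (yword LL os x)) | x <- B] =
    map (@rights _ _) (map (@lets _) (ywords (ykey_of LL os B))).
  rewrite -map_comp -[ywords _](@map_nth_index _ _ [::] B) -?map_comp.
  - by apply/eq_in_map => x Bx /=; rewrite /yword (linkE LLdis LLB Bx).
  - exact: uB.
  - by rewrite size_ywords (size_orders (orders_of LLB)).
rewrite -rights_flatten lets_ywords.
by rewrite (map_comp inr) rights_inr.
Qed.

Lemma yrule_ok (r := yrule (A, (u, LL)) os) :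
  [/\ r.1 \in ykeys, {subset r.2.2 <= ykeys}, uniq r.2.2,
      size r.2.1 = ydim r.1 &
      perm_eq (rights (flatten r.2.1))
              [seq (k, j) | k <- r.2.2, j <- iota 0 (ydim k)]].
Proof.
have [AG _ _ [uLL LLG] _] := rules_ok rG; split => /=.
- by rewrite mem_ykeys AG vars_ywords_of.
- by move=> k /mapP[B LLB ->]; rewrite mem_ykeys LLG ?orders_of.
- by rewrite map_inj_uniq // => B B' [].
- exact: size_flatten_gaps.
rewrite flatten_flatten -map_comp (eq_map (@flatten_gaps _)) -lets_flatten.
exact: rights_ywords_of.
Qed.

(** [hom_ev] moves the specialization into the interpretation of nonterminals, where [hom_ywords]
    makes symbolic words actual. Both directions of the simulation rest on this commutation. *)
Lemma ev_ywords_of (f : seq N -> seq (tree (sym N T))) (f' : ykey -> seq (seq U)) :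
  {in LL, forall B, size (f B) = size B} ->
  {in LL, forall B, map (@vars _) (map (ev0 val) (f B)) = order_of LL os B} ->
  {in LL, forall B, f' (ykey_of LL os B) =
                    flatten (map (@gaps _) (map (ev0 val) (f B)))} ->
  map (hom (expand f')) (ywords_of LL os u) = map (ev0 val) (fsubst LL f u).
Proof.
have [_ _ _ _ [LLdis LLu]] := rules_ok rG => szf fo ff'.
rewrite ev_fsubst // => [|x]; last by rewrite LLu.
rewrite -map_comp; apply/eq_in_map => t ut /=; rewrite hom_ev.
have /eq_ev-> : hom_word (expand f') \o yval =1 val.
  by move=> b; rewrite /= /yval /hom_word -map_comp flatten_seq1.
apply: eq_in_ev => x xt /=.
have LLx : x \in flatten LL.
  by rewrite LLu; apply/flattenP; exists (word t); rewrite ?map_f.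
have LLB := link_mem LLx; have <- : map (hom (expand f'))
    (ywords (ykey_of LL os (link LL x))) = map (ev0 val) (f (link LL x)).
  by have := ff' _ LLB; rewrite /ykey_of -fo //; apply: hom_ywords.
rewrite (nth_map [::]) // size_ywords (size_orders (orders_of (link_mem LLx))).
by rewrite index_mem mem_link.
Qed.

End RuleFacts.

Lemma ydim_gt0 : {in ykeys, forall k, 0 < ydim k}.
Proof.
case=> A jss; rewrite mem_ykeys => /andP[AG /size_orders].
have [A0 _] := bignt_rep_free AG; rewrite /ydim /=.
by case: jss A A0 {AG} => [|js jss] [|x A].
Qed.

Lemma ystart_key : ([:: init G], [:: [::]]) \in ykeys.
Proof.
by rewrite mem_ykeys init_bignt mem_cart_prod /= mem_permutations init_rank.
Qed.

Lemma yrules_ok : {in yrules, forall r,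
  [/\ r.1 \in ykeys, {subset r.2.2 <= ykeys}, uniq r.2.2,
      size r.2.1 = ydim r.1 &
      perm_eq (rights (flatten r.2.1))
              [seq (k, j) | k <- r.2.2, j <- iota 0 (ydim k)]]}.
Proof.
move=> r /allpairsPdep[[A [u LL]] [os [rG osP ->]]].
exact: yrule_ok.
Qed.

Definition ygrammar : sgrammar U :=
  @SGrammar U ykey ykeys ydim ([:: init G], [:: [::]]) yrules
    ydim_gt0 ystart_key erefl yrules_ok.

(** The claim records the orders of the variables as well, since the gaps alone do not determine the
    words of the components. *)
Lemma ygrammar_sound (k : ykey) ws :
  @slang U ygrammar k ws ->
  exists v, [/\ forest_lang k.1 v, map (@vars _) (map (ev0 val) v) = k.2 &
    flatten (map (@gaps _) (map (ev0 val) v)) = ws].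
Proof.
elim=> {k ws} k us ks f' /allpairsPdep[[A [u LL]] [os [rG /= osP]]].
case=> -> -> -> _ IHf.
have [|f fP] := @finite_choice _ _ [::] (fun B v =>
    [/\ @forest_lang _ _ G B v, map (@vars _) (map (ev0 val) v) = order_of LL os B &
    flatten (map (@gaps _) (map (ev0 val) v)) = f' (ykey_of LL os B)]) LL.
  by move=> B LLB; apply: (IHf (ykey_of LL os B)); apply: map_f.
exists (fsubst LL f u).
have szf : {in LL, forall B, size (f B) = size B}.
  by move=> B /fP[/forest_lang_size].
have <- := ev_ywords_of (f := f) (f' := f') rG osP szf.
- split=> /=.
  + by apply: Forest_lang rG _ => B /fP[].
  + by rewrite -map_comp; apply: eq_map => y /=; rewrite vars_hom.
  + rewrite map_flatten -!map_comp; congr flatten.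
    by apply: eq_map => y /=; rewrite gaps_hom.
- by move=> B /fP[].
- by move=> B /fP[].
Qed.

Lemma ygrammar_complete A v (ys := map (ev0 val) v) :
  @forest_lang _ _ G A v ->
  @slang U ygrammar (A, map (@vars _) ys) (flatten (map (@gaps _) ys)).
Proof.
rewrite {}/ys; elim=> {A v} A u LL f rG fG IHf.
(* The right guesses are the orders occurring in the derived forests. *)
pose os := [seq map (@vars _) (map (ev0 val) (f B)) | B <- LL].
have osE : {in LL, forall B, order_of LL os B = map (@vars _) (map (ev0 val) (f B))}.
  move=> B LLB; rewrite /order_of (nth_map [::]) ?index_mem //.
  by rewrite nth_index.
have osP : os \in cart_prod (map orders LL).
  apply: map_cart_prod => B LLB.
  have [_ wfB] := forest_lang_well_formed val (fG B LLB).
  rewrite mem_cart_prod -map_comp; apply: all2_map_impl wfB _ => x t _ _.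
  by rewrite mem_permutations => /andP[].
(* The first component of a key is the link itself, which tells which forest to take. *)
pose f' (k : ykey) := flatten (map (@gaps _) (map (ev0 val) (f k.1))).
have rY : yrule (A, (u, LL)) os \in yrules.
  by apply/allpairsPdep; exists (A, (u, LL)), os.
have := @Slang U ygrammar _ _ _ f' rY.
have -> : map (hom_word (expand f')) (flatten (map (@gaps _) (ywords_of LL os u))) =
    flatten (map (@gaps _) (map (hom (expand f')) (ywords_of LL os u))).
  rewrite map_flatten -!map_comp; congr flatten.
  by apply: eq_map => y /=; rewrite gaps_hom.
have -> : map (@vars _) (ywords_of LL os u) =
    map (@vars _) (map (hom (expand f')) (ywords_of LL os u)).
  by rewrite -map_comp; apply: eq_map => y /=; rewrite vars_hom.
rewrite (ev_ywords_of (f := f) rG osP) //.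
- apply=> k /mapP[B LLB ->]; rewrite /ykey_of osE //.
  exact: IHf.
- by move=> B /fG/forest_lang_size.
- by move=> B LLB; rewrite osE.
Qed.

End YieldGrammar.

Definition yield (T U : Type) (val : T -> seq U) (t : tree T) : seq U :=
  flatten (map val (word t)).

Lemma ev_tree_map (N T : eqType) (U : Type) (val : T -> seq U) (t : tree T) :
  ev0 val (tree_map (@Tm N T) t) = map inl (yield val t).
Proof.
rewrite /ev0; elim/tree_ind_in: t => a ts IHts.
rewrite /= /yield /= map_cat; congr (_ ++ _).
elim: ts IHts => //= t ts IH IHts.
rewrite IHts ?mem_head // IH => [|s sts]; last by apply: IHts; rewrite inE sts orbT.
by rewrite -map_cat -flatten_cat -map_cat.
Qed.

(** The start key has a single component without variables, so its only gap is the whole yield. *)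
Lemma ygrammar_lang (T : eqType) (Sg : ralphabet T) (G : mcftg Sg) (U : eqType)
    (val : T -> seq U) w :
  slang (start (ygrammar G val)) [:: w] <->
  exists2 t, tree_lang G t & yield val t = w.
Proof.
split=> [/ygrammar_sound[v [/= vG]] | [t tG <-]].
  have [_] := forest_lang_well_formed val vG.
  case: v vG => [|t []] //= vG /andP[/andP[ct _] _] [t0].
  rewrite cats0 (gaps_no_vars t0) => -[<-].
  move: ct; rewrite init_rank => /nt_free0_map[t' tE]; exists t'.
    by rewrite /tree_lang -tE.
  by rewrite tE ev_tree_map lets_inl.
have := ygrammar_complete val tG; rewrite /= ev_tree_map vars_inl cats0.
by rewrite gaps_no_vars ?lets_inl // vars_inl.
Qed.

(** * From grammars on tuples of strings to MCFGs and MRTGs *)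

Lemma slang_size (U : eqType) (H : sgrammar U) k ws :
  @slang U H k ws -> size ws = dim k /\ k \in keys H.
Proof. by case=> {}k us ks f /srules_ok[/= -> _ _ <- _] _; rewrite size_map. Qed.

Lemma mem_lefts (X Y : eqType) (s : seq (X + Y)) x : (x \in lefts s) = (inl x \in s).
Proof. by elim: s => //= -[x'|y] s; rewrite !inE => ->. Qed.

Lemma mem_rights (X Y : eqType) (s : seq (X + Y)) y : (y \in rights s) = (inr y \in s).
Proof. by elim: s => //= -[x|y'] s; rewrite !inE => ->. Qed.

(** * Strings as monadic trees or as combs *)

Section Encoding.
Variables (U : eqType) (H : sgrammar U).

(* [mono] selects between an MCFG, where strings are monadic trees, and an
   MRTG, where strings are combs whose spine is labeled by the binary symbol
   [c]. *)
Variables (mono : bool) (c : U).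
Local Notation K := (key H).

Definition components : seq (K * nat) :=
  [seq (k, j) | k <- keys H, j <- iota 0 (dim k)].

Definition used_letters : seq U :=
  lefts (flatten (flatten [seq r.2.1 | r <- srules H])).

Hypothesis c_fresh : c \notin used_letters.

(* [None] is the initial nonterminal. *)
Definition enonterm : finType := option (seq_sub components).

(** Outside [components] the value is [None], the initial nonterminal; hence the membership
    hypotheses in the lemmas on [enc]. *)
Definition enc (p : K * nat) : enonterm := insub p.

Definition encs (k : K) : seq enonterm := [seq enc (k, j) | j <- iota 0 (dim k)].

Definition erank (x : enonterm) : nat := if x is Some _ then mono else 0.

(** Listing [c] in both modes guarantees a symbol of positive rank even if no letter occurs in the
    rules. *)
Definition ealphabet : ralphabet (option U) :=
  RAlphabet [:: None, Some c & map Some used_letters]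
    (fun x => if x is Some a then if mono then 1 else if a == c then 2 else 0 else 0).

Definition enc_sym (a : U + K * nat) : sym enonterm (option U) :=
  match a with inl a => Tm (Some a) | inr p => NT (enc p) end.

Definition econs (x : sym enonterm (option U)) t :=
  if mono then Node x [:: t] else Node (Tm (Some c)) [:: Node x [::]; t].

(** Concatenation of strings is composition of monadic trees, so component trees must end in the
    hole [Var 0] there; in a comb a component is hung on the spine as a leaf. *)
Definition etree (var : bool) (s : seq (U + K * nat)) :
    tree (sym enonterm (option U)) :=
  foldr (fun a => econs (enc_sym a)) (Node (if var then Var 0 else Tm None) [::]) s.

(** The first rule starts from a fresh nonterminal of rank 0, since the start component has rank 1
    in the monadic mode and may occur in right-hand sides. *)
Definition erules : seq (rule (option U) enonterm) :=
  ([:: None], ([:: etree false [:: inr (start H, 0)]], [:: encs (start H)])) ::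
  [seq (encs r.1, (map (etree mono) r.2.1, map encs r.2.2)) | r <- srules H].

Definition ebignt : seq (seq enonterm) := [:: None] :: map encs (keys H).

Lemma mem_components k j : ((k, j) \in components) = (k \in keys H) && (j < dim k).
Proof.
apply/allpairsPdep/andP => [[k' [j' [kH]]]|[kH kj]].
  by rewrite mem_iota => kj [-> ->].
by exists k, j; rewrite mem_iota.
Qed.

Lemma enc_inj p q : p \in components -> enc p = enc q -> p = q.
Proof.
rewrite /enc => pC; rewrite insubT; case: insubP => // y _ <- /Some_inj <-.
by rewrite SubK.
Qed.

Lemma enc_neq_None p : p \in components -> enc p != None.
Proof. by rewrite /enc => pC; rewrite insubT. Qed.

Lemma mem_encs k j : k \in keys H -> j < dim k -> enc (k, j) \in encs k.
Proof. by move=> kH kj; apply: map_f; rewrite mem_iota. Qed.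

Lemma encsP k x :
  k \in keys H -> x \in encs k -> exists2 j, x = enc (k, j) & (k, j) \in components.
Proof.
move=> kH /mapP[j]; rewrite mem_iota => kj ->; exists j => //.
by rewrite mem_components kH.
Qed.

Lemma None_notin_encs k : k \in keys H -> None \notin encs k.
Proof.
move=> kH; apply/negP => /(encsP kH)[j /esym/eqP jN jC].
by move: (enc_neq_None jC); rewrite jN.
Qed.

Lemma size_encs k : size (encs k) = dim k.
Proof. by rewrite size_map size_iota. Qed.

Lemma uniq_encs k : k \in keys H -> uniq (encs k).
Proof.
move=> kH; rewrite map_inj_in_uniq ?iota_uniq // => i j.
rewrite !mem_iota => ik jk /enc_inj; rewrite mem_components kH.
by case/(_ ik).
Qed.

(** An encoded component remembers its key; this makes distinct big nonterminals disjoint. *)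
Lemma encs_share k k' x :
  k \in keys H -> k' \in keys H -> x \in encs k -> x \in encs k' -> k = k'.
Proof.
by move=> kH k'H /(encsP kH)[j -> jC] /(encsP k'H)[j' /(enc_inj jC)[]].
Qed.

Lemma encs_inj : {in keys H &, injective encs}.
Proof.
move=> k k' kH k'H kk'; have k0 := dim_gt0 kH.
apply: (encs_share kH k'H (mem_encs kH k0)); rewrite -kk'.
exact: mem_encs.
Qed.

Lemma ebignt_rep_free : {in ebignt, forall A : seq enonterm, A != [::] /\ uniq A}.
Proof.
move=> A; rewrite inE => /predU1P[-> //|/mapP[k kH ->]].
by rewrite uniq_encs // -size_eq0 size_encs -lt0n dim_gt0.
Qed.

Lemma ebignt_occ_inj : {in ebignt &, forall A A' : seq enonterm, A != A' -> ~ A =i A'}.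
Proof.
move=> A A'; rewrite !inE => /predU1P[->|/mapP[k kH ->]] /predU1P[->|/mapP[k' k'H ->]].
- by rewrite eqxx.
- by move=> _ /(_ None); rewrite mem_head (negbTE (None_notin_encs k'H)).
- by move=> _ /(_ None); rewrite mem_head (negbTE (None_notin_encs kH)).
move=> neq eqi; case/eqP: neq; congr encs.
have k0 := dim_gt0 kH; apply: (encs_share kH k'H (mem_encs kH k0)).
by rewrite -eqi; apply: mem_encs.
Qed.

(** * The encoded rules satisfy the conditions on tree grammar rules *)

Lemma nts_etree var s : nts (word (etree var s)) = map enc (rights s).
Proof.
elim: s => [|a s IHs]; first by case: var.
by rewrite /= /econs; case: mono => /=; rewrite cats0 IHs; case: a.
Qed.

Lemma nts_fword_etree var us :
  nts (fword (map (etree var) us)) = map enc (rights (flatten us)).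
Proof.
elim: us => //= s us IHus.
by rewrite /nts pmap_cat -!/(nts _) IHus nts_etree -map_cat /rights pmap_cat.
Qed.

Definition good (a : U + K * nat) : bool :=
  match a with inl a => a \in used_letters | inr p => p \in components end.

Lemma etree_pattern (var : bool) s :
  all good s -> is_pattern ealphabet erank var (etree var s).
Proof.
move=> gs; apply/and3P; split.
- elim: s gs => [|a s IHs] /=; first by case: var.
  case/andP=> ga /IHs ws; rewrite /econs.
  have ra : sym_rank ealphabet erank (enc_sym a) = mono.
    case: a ga => [a|p] /= ga; last by case: (enc p) (enc_neq_None ga).
    (* Freshness of [c] gives letters rank 0 in the comb mode. *)
    have ac : a != c by apply: contraNneq c_fresh => <-.
    by rewrite (negbTE ac); case: mono.
  case: ifP => m; first by rewrite /= ra m ws.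
  by rewrite /= m eqxx ra m ws.
- elim: s gs => [|a s IHs] /=; first by case: var.
  case/andP=> ga /IHs ws; rewrite /econs.
  have oa : sym_over ealphabet var (enc_sym a).
    by case: a ga => [a|p] //= ga; rewrite !inE map_f ?orbT.
  by case: mono => /=; rewrite cats0 ?inE ?eqxx ?orbT oa ws.
apply/allP => j; rewrite mem_iota; case: var j => // -[] // _.
elim: s gs => [|a s IHs] //= /andP[ga /IHs /eqP ws]; rewrite /econs.
by case: ifP => m; rewrite /= cats0 ws; case: a ga.
Qed.

(** The permutation hypothesis serves twice: absence of repetitions gives unique labeling, and
    equality of the underlying sets says that the links cover exactly the nonterminals present. *)
Lemma is_rule_etree A (var : bool) us ks :
  A \in ebignt -> size us = size A -> all (fun x => erank x == var) A ->
  {subset ks <= keys H} -> uniq ks -> {subset lefts (flatten us) <= used_letters} ->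
  perm_eq (rights (flatten us)) [seq (k, j) | k <- ks, j <- iota 0 (dim k)] ->
  is_rule ealphabet erank ebignt (A, (map (etree var) us, map encs ks)).
Proof.
move=> AB szA rkA ksH uks lus rus.
have memr k j : ((k, j) \in rights (flatten us)) = (k \in ks) && (j < dim k).
  rewrite (perm_mem rus); apply/allpairsPdep/andP => [[k' [j' [kH]]]|[kH kj]].
    by rewrite mem_iota => kj [-> ->].
  by exists k, j; rewrite mem_iota.
have goodus : all good (flatten us).
  apply/allP => -[a|[k j]] us_a /=; first by apply: lus; rewrite mem_lefts.
  have : (k, j) \in rights (flatten us) by rewrite mem_rights.
  by rewrite memr mem_components => /andP[/ksH-> ->].
split=> //.
- elim: (A) (us) szA rkA goodus => [|x B IHB] [|s ts] //= [szB] /andP[/eqP rx rB].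
  by rewrite all_cat => /andP[gs gts]; rewrite rx etree_pattern //= IHB.
- move=> x; rewrite -count_nts nts_fword_etree count_uniq_mem ?leq_b1 //.
  rewrite map_inj_in_uniq.
    rewrite (perm_uniq rus); apply: allpairs_uniq_dep => // [k _|].
      exact: iota_uniq.
    by move=> [k j] [k' j'] _ _ /= [-> ->].
  move=> [k j] q; rewrite memr => /andP[/ksH kH kj] _; apply: enc_inj.
  by rewrite mem_components kH.
- split; first by rewrite map_inj_in_uniq // => k k' /ksH kH /ksH; apply: encs_inj.
  by move=> _ /mapP[k /ksH kH ->]; rewrite inE map_f ?orbT.
split=> [_ _ /mapP[k /ksH kH ->] /mapP[k' /ksH k'H ->] kk'|x].
  rewrite disjoint_has; apply/hasPn => x xk; apply: contraNN kk' => xk'.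
  by rewrite (encs_share kH k'H xk xk').
rewrite -mem_nts nts_fword_etree; apply/flattenP/mapP => [[_ /mapP[k kks ->]]|[[k j]]].
  move=> /mapP[j]; rewrite mem_iota => kj ->.
  by exists (k, j); rewrite // memr kks.
rewrite memr => /andP[kks kj] ->; exists (encs k); first exact: map_f.
by apply: mem_encs => //; apply: ksH.
Qed.

Lemma all_erank k : k \in keys H -> all (fun x => erank x == mono) (encs k).
Proof.
move=> kH; apply/allP => x /(encsP kH)[j -> jC].
by case: (enc _) (enc_neq_None jC) => /=.
Qed.

Lemma used_lettersP r :
  r \in srules H -> {subset lefts (flatten r.2.1) <= used_letters}.
Proof.
move=> rH a; rewrite !mem_lefts => /flattenP[s rs sa].
apply/flattenP; exists s => //; apply/flattenP; exists r.2.1 => //.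
by apply/mapP; exists r.
Qed.

Lemma erules_ok : {in erules, forall r, is_rule ealphabet erank ebignt r}.
Proof.
move=> r; rewrite inE => /predU1P[->|/mapP[[k [us ks]] rH ->]].
  apply: (@is_rule_etree [:: None] false [:: [:: inr (start H, 0)]] [:: start H]) => //.
  - by move=> k; rewrite inE => /eqP->; apply: start_key.
  - by rewrite /= dim_start.
have [/= kH ksH uks szus pus] := srules_ok rH.
apply: is_rule_etree => //=.
- by rewrite inE map_f ?orbT.
- by rewrite size_encs.
- exact: all_erank.
- exact: (used_lettersP rH).
Qed.

Lemma ehas_pos : has (fun b => 0 < rank ealphabet b) (letters ealphabet).
Proof. by rewrite /= eqxx; case: mono. Qed.

Definition egrammar : mcftg ealphabet :=
  @MCFTG (option U) ealphabet enonterm erank ebignt None erules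
    ebignt_rep_free ebignt_occ_inj ehas_pos (mem_head _ _) erefl erules_ok.

(** * Yields of the encoded grammar *)

Definition eval (x : option U) : seq U :=
  if x is Some a then if ~~ mono && (a == c) then [::] else [:: a] else [::].

(** The word of a component tree that encodes [s], with its hole at the end in the monadic mode. *)
Definition lift (var : bool) (s : seq U) : seq (U + nat) :=
  map inl s ++ (if var then [:: inr 0] else [::]).

Lemma ev_etree g f var s :
  all good s ->
  (forall k j, inr (k, j) \in s -> g (enc (k, j)) = lift mono (nth [::] (f k) j)) ->
  ev eval g (etree var s) = lift var (hom_word (expand f) s).
Proof.
elim: s => [|a s IHs] /=; first by case: var.
case/andP=> ga gs gE.
have {}IHs : ev eval g (etree var s) = lift var (hom_word (expand f) s).
  by apply: IHs => // k j sj; apply: gE; rewrite inE sj orbT.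
have evE : ev eval g (econs (enc_sym a) (etree var s)) =
    map inl (expand f a) ++ ev eval g (etree var s).
  rewrite /econs; case: a ga gE => [a|[k j]] /= ga gE.
    have ac : a != c by apply: contraNneq c_fresh => <-.
    by case: ifP => m; rewrite /= ?m ?eqxx (negbTE ac) ?andbF /= ?cats0.
  (* In the monadic mode the rest of the string is substituted for the final variable; in a comb the
     value is constant and the rest follows on the spine. *)
  have gk := gE k j (mem_head _ _); case: ifP => m; rewrite /= ?m ?eqxx gk /lift m.
    by rewrite wsub_cat wsub_inl /wsub /= cats0.
  by rewrite !cats0 wsub_inl.
by rewrite evE IHs /lift /hom_word /= map_cat catA.
Qed.

(** One rule application commutes with evaluation. [var] is [false] for the initial rule and [mono]
    for the others. *)
Lemma ev_erule var us ks f f' :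
  {subset ks <= keys H} -> {subset lefts (flatten us) <= used_letters} ->
  perm_eq (rights (flatten us)) [seq (k, j) | k <- ks, j <- iota 0 (dim k)] ->
  {in ks, forall k, size (f' k) = dim k} ->
  {in ks, forall k, map (ev0 eval) (f (encs k)) = map (lift mono) (f' k)} ->
  map (ev0 eval) (fsubst (map encs ks) f (map (etree var) us)) =
  map (lift var) (map (hom_word (expand f')) us).
Proof.
move=> ksH lus rus szf' ff'.
have disj : {in map encs ks &,
    forall B B' : seq enonterm, B != B' -> [disjoint B & B']}.
  move=> _ _ /mapP[k /ksH kH ->] /mapP[k' /ksH k'H ->] kk'.
  rewrite disjoint_has; apply/hasPn => x xk; apply: contraNN kk' => xk'.
  by rewrite (encs_share kH k'H xk xk').
have usP k j : inr (k, j) \in flatten us -> (k \in ks) && (j < dim k).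
  rewrite -mem_rights (perm_mem rus) => /allpairsPdep[k' [j' [kks]]].
  by rewrite mem_iota => kj [-> ->]; rewrite kks.
have goodus : all good (flatten us).
  apply/allP => -[a|[k j]] us_a /=; first by apply: lus; rewrite mem_lefts.
  by case/andP: (usP _ _ us_a) => /ksH kH kj; rewrite mem_components kH.
rewrite ev_fsubst.
- rewrite -!map_comp; apply/eq_in_map => s ss /=; apply: ev_etree.
    by apply/allP => a sa; apply: (allP goodus); apply/flattenP; exists s.
  move=> k j sj; have /usP/andP[kks kj] : inr (k, j) \in flatten us.
    by apply/flattenP; exists s.
  have kH := ksH _ kks.
  rewrite (linkE disj (map_f _ kks) (mem_encs kH kj)) ff' //.
  have -> : index (enc (k, j)) (encs k) = j.
    have jE : nth None (encs k) j = enc (k, j).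
      by rewrite (nth_map 0) ?size_iota // nth_iota.
    by rewrite -jE index_uniq ?size_encs // uniq_encs.
  by rewrite (nth_map [::]) // szf'.
- move=> _ /mapP[k kks ->].
  by rewrite size_encs -(szf' _ kks) -(size_map (ev0 eval)) ff' // size_map.
move=> x; rewrite -mem_nts nts_fword_etree => /mapP[[k j]].
rewrite mem_rights => /usP/andP[kks kj] ->; apply/flattenP.
by exists (encs k); [apply: map_f | apply: mem_encs => //; apply: ksH].
Qed.

Lemma ev_start_erule f w :
  map (ev0 eval) (f (encs (start H))) = [:: lift mono w] ->
  map (ev0 eval) (fsubst [:: encs (start H)] f [:: etree false [:: inr (start H, 0)]]) =
  [:: map inl w].
Proof.
move=> fE; have -> : [:: map inl w] = map (lift false)
    (map (hom_word (expand (fun=> [:: w]))) [:: [:: inr (start H, 0)]]).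
  by rewrite /lift /hom_word /= !cats0.
apply: (@ev_erule false [:: [:: inr (start H, 0)]] [:: start H]) => //.
- by move=> k; rewrite inE => /eqP->; apply: start_key.
- by rewrite /= dim_start.
- by move=> k; rewrite inE => /eqP->; rewrite dim_start.
- by move=> k; rewrite inE => /eqP->.
Qed.

(** Both claims go through one induction, since the initial rule calls an encoded key;
    [None_notin_encs] keeps the two cases apart. *)
Lemma egrammar_sound A v :
  @forest_lang _ _ egrammar A v ->
  (A = [:: None] -> exists2 w, slang (start H) [:: w] &
    map (ev0 eval) v = [:: map inl w]) /\
  (forall k, k \in keys H -> A = encs k ->
    exists2 ws, slang k ws & map (ev0 eval) v = map (lift mono) ws).
Proof.
elim=> {A v} A u LL f + _ IHf; rewrite inE => /predU1P[[-> uE LLE]|].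
  split=> [_|k kH kE]; last by move: (None_notin_encs kH); rewrite -kE mem_head.
  have startLL : encs (start H) \in LL by rewrite LLE mem_head.
  have [_ /(_ _ (start_key H) erefl) [ws wsH fE]] := IHf _ startLL.
  have [szws _] := slang_size wsH; rewrite dim_start in szws.
  case: ws szws wsH fE => [|w []] // _ wH fE; exists w => //.
  by rewrite uE LLE (ev_start_erule fE).
case/mapP=> -[k [us ks]] rH [AE uE LLE].
have [/= kH ksH uks szus pus] := srules_ok rH.
split=> [AN|k' k'H Ak']; first by move: (None_notin_encs kH); rewrite -AE AN mem_head.
have {k' k'H Ak'} <- : k = k' by apply: encs_inj; rewrite -?AE.
have [|f' f'P] := @finite_choice _ _ [::] (fun k ws => @slang U H k ws /\
    map (ev0 eval) (f (encs k)) = map (lift mono) ws) ks.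
  move=> k' k'ks; have k'LL : encs k' \in LL by rewrite LLE map_f.
  by have [_ /(_ _ (ksH _ k'ks) erefl) [ws]] := IHf _ k'LL; exists ws.
exists (map (hom_word (expand f')) us).
  by apply: Slang rH _ => k' /f'P[].
rewrite uE LLE; apply: ev_erule => //.
- exact: (used_lettersP rH).
- by move=> k' /f'P[/slang_size[]].
- by move=> k' /f'P[].
Qed.

Lemma egrammar_complete k ws :
  @slang U H k ws ->
  exists2 v, @forest_lang _ _ egrammar (encs k) v &
    map (ev0 eval) v = map (lift mono) ws.
Proof.
elim=> {k ws} k us ks f' rH f'H IHf.
have [/= kH ksH uks szus pus] := srules_ok rH.
(* Forests are indexed by big nonterminals and tuples by keys; injectivity of [encs] recovers the
   key. *)
have [|f fP] := @finite_choice _ _ [::] (fun B v => @forest_lang _ _ egrammar B v /\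
    (forall k', k' \in ks -> B = encs k' ->
      map (ev0 eval) v = map (lift mono) (f' k'))) (map encs ks).
  move=> _ /mapP[k' k'ks ->]; have [v vG vE] := IHf _ k'ks.
  exists v; split=> // k'' k''ks kk.
  by rewrite -(encs_inj (ksH _ k'ks) (ksH _ k''ks) kk).
exists (fsubst (map encs ks) f (map (etree mono) us)).
  apply: Forest_lang => [|B /fP[] //].
  by rewrite inE; apply/orP; right; apply/mapP; exists (k, (us, ks)).
apply: ev_erule => //.
- exact: (used_lettersP rH).
- by move=> k' /f'H /slang_size[].
- by move=> k' k'ks; have [_] := fP _ (map_f encs k'ks); apply.
Qed.

Lemma egrammar_lang w :
  slang (start H) [:: w] <-> exists2 t, tree_lang egrammar t & yield eval t = w.
Proof.
split=> [wH|[t tG <-]]; last first.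
  have [/(_ erefl)[w' w'H] + _] := egrammar_sound tG.
  by rewrite /= ev_tree_map => -[/(inj_map (@inl_inj _ _))->].
have [v vG vE] := egrammar_complete wH.
have tG : @forest_lang _ _ egrammar [:: None]
    (fsubst [:: encs (start H)] (fun=> v) [:: etree false [:: inr (start H, 0)]]).
  by apply: Forest_lang => [|B]; rewrite ?mem_head // inE => /eqP->.
have [tE] := ev_start_erule (f := fun=> v) vE.
(* The derived tree has neither nonterminals nor variables, so it comes from a tree over terminals,
   as [tree_lang] demands. *)
have [_ /= /andP[/andP[ct _] _]] := forest_lang_well_formed eval tG.
have [t tt] := nt_free0_map ct; exists t; first by rewrite /tree_lang -tt.
by move: tE; rewrite tt ev_tree_map => /(inj_map (@inl_inj _ _)).
Qed.

End Encoding.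

(** * Comparing the classes of string languages *)

Section StringLanguages.
Variable U : eqType.
Implicit Type L : seq U -> Prop.

Definition sgrammar_class L : Prop :=
  exists H : sgrammar U, forall w, L w <-> slang (start H) [:: w].

Lemma yield_string_tree (w : seq U) : yield (@seq_of_opt U) (string_tree w) = w.
Proof. by elim: w => //= a w; rewrite /yield /= cats0 => ->. Qed.

Lemma yd_yield Sg t :
  yd Sg t = yield (fun b => if rank Sg b == 0 then @seq_of_opt U b else [::]) t.
Proof.
rewrite /yd /yield; elim: (word t) => //= b w ->.
by case: (rank Sg b == 0); case: b.
Qed.

(** The end marker is a leaf and all other terminals are unary, so a derived tree is a chain
    determined by its labels. *)
Lemma mcfg_string_tree (Sg : ralphabet (option U)) (G : mcftg Sg) t :
  is_mcfg G -> tree_lang G t -> t = string_tree (yield (@seq_of_opt U) t).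
Proof.
case=> [[_ rN] rS _ _] /(forest_lang_well_formed (@seq_of_opt U))[_].
rewrite /= andbT => /andP[+ _]; rewrite init_rank.
elim/tree_ind_in: t => a ts IHts /=; rewrite nt_free_node /= size_map.
case/and3P=> sz aS /allP cts; case: a sz aS => [a|] sz aS; last first.
  by move: sz; rewrite rN; case: (ts).
move: sz; rewrite rS //; case: ts IHts cts => [|t []] //= IHts cts _.
rewrite cats0 -[flatten _]/(yield (@seq_of_opt U) t).
by rewrite -IHts ?mem_head // cts ?mem_head.
Qed.

(** The gap construction is applied with the valuation that erases only the end marker. *)
Lemma MCF_sgrammar L : MCF L -> sgrammar_class L.
Proof.
case=> Sg [G [mG LG]]; exists (ygrammar G (@seq_of_opt U)) => w.
apply: iff_trans (LG w) _; apply: iff_trans (iff_sym (ygrammar_lang _ _ _)).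
split=> [wG|[t tG <-]]; last by rewrite -(mcfg_string_tree mG tG).
by exists (string_tree w); rewrite ?yield_string_tree.
Qed.

Lemma yMCFT_sgrammar L : yield_class (@MCFT _) L -> sgrammar_class L.
Proof.
case=> Sg [M [_ [G MG] LM]].
exists (ygrammar G (fun b => if rank Sg b == 0 then @seq_of_opt U b else [::])) => w.
apply: iff_trans (LM w) _; apply: iff_trans (iff_sym (ygrammar_lang _ _ _)).
by split=> -[t tG <-]; exists t; rewrite ?yd_yield //; apply/MG.
Qed.

Hypothesis infU : forall s : seq U, exists a : U, a \notin s.

Lemma sgrammar_MCF L : sgrammar_class L -> MCF L.
Proof.
case=> H LH; have [c cH] := infU (used_letters H).
pose G := egrammar true cH.
have mG : is_mcfg G.
  split=> //; first by case.
  (* Right-hand sides contain only codes of components, none of which is the initial [None]. *)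
  move=> r; rewrite inE => /predU1P[->|/mapP[r' r'H ->]].
    rewrite -mem_nts (nts_fword_etree _ _ _ [:: [:: inr (start H, 0)]]).
    by rewrite inE eq_sym enc_neq_None // mem_components start_key dim_start.
  rewrite -mem_nts nts_fword_etree; apply/mapP => -[p pr /esym/eqP].
  apply/negP/enc_neq_None.
  have [_ r'ks _ _ /perm_mem rE] := srules_ok r'H; move: pr; rewrite rE.
  case/allpairsPdep=> k [j [/r'ks kH]]; rewrite mem_iota => kj ->.
  by rewrite mem_components kH.
exists (ealphabet H true c), G; split=> // w.
apply: iff_trans (LH w) _; apply: iff_trans (egrammar_lang true cH w) _.
have -> : yield (eval true c) = yield (@seq_of_opt U) by [].
split=> [[t tG <-]|wG]; first by rewrite -(mcfg_string_tree mG tG).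
by exists (string_tree w) => //; apply: yield_string_tree.
Qed.

(** In the comb mode all nonterminals have rank 0, and the spine symbol, of rank 2, is invisible to
    [yd]. *)
Lemma sgrammar_yMRT L : sgrammar_class L -> yield_class (@MRT _) L.
Proof.
case=> H LH; have [c cH] := infU (used_letters H).
exists (ealphabet H false c), (tree_lang (egrammar false cH)); split=> //.
  by exists (egrammar false cH); split=> // -[].
move=> w; apply: iff_trans (LH w) _; apply: iff_trans (egrammar_lang false cH w) _.
have ydE t : yd (ealphabet H false c) t = yield (eval false c) t.
  rewrite yd_yield /yield; congr flatten; apply: eq_map => -[a|] //=.
  by case: (a == c).
by split=> -[t tG <-]; exists t; rewrite ?ydE.
Qed.

Lemma yMRT_yMCFT L : yield_class (@MRT _) L -> yield_class (@MCFT _) L.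
Proof. by case=> Sg [M [rN [G [_ MG]] LM]]; exists Sg, M; split=> //; exists G. Qed.

End StringLanguages.

(* MathComp world.  [U] is the (infinite) supply of symbols from which finite
   alphabets are drawn. *)
Theorem corollary70 (U : eqType)
    (infU : forall s : seq U, exists a : U, a \notin s) :
  (forall L : seq U -> Prop, yield_class (@MCFT _) L <-> MCF L) /\
  (forall L : seq U -> Prop, MCF L <-> yield_class (@MRT _) L).
Proof.
split=> L; split.
- by move/yMCFT_sgrammar/(sgrammar_MCF infU).
- by move/MCF_sgrammar/(sgrammar_yMRT infU)/yMRT_yMCFT.
- by move/MCF_sgrammar/(sgrammar_yMRT infU).
- by move/yMRT_yMCFT/yMCFT_sgrammar/(sgrammar_MCF infU).
Qed.
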